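(* Let $c>2$ be an integer. Then the set of non-synchronizing points in the charge constrained shift $X_c$ is uncountable.
   Context: For a positive integer $c$, the charge constrained shift $X_c\subseteq\{+1,-1\}^{\mathbb Z}$ is the set of all sequences $x\in\{+1,-1\}^{\mathbb Z}$ such that the sum $s$ of the entries of any finite subword (block of consecutive entries) of $x$ satisfies $-c\le s\le c$. It is a shift space (closed and shift-invariant). For a shift space $X$, $\mathcal L(X)$ denotes the set of finite words (including the empty word) occurring in elements of $X$; a word $w\in\mathcal L(X)$ is synchronizing if whenever $u,v\in\mathcal L(X)$ satisfy $uw\in\mathcal L(X)$ and $wv\in\mathcal L(X)$, then $uwv\in\mathcal L(X)$; a point of $X$ is synchronizing if it contains a synchronizing word, and non-synchronizing otherwise. *)

(* Defs.v *)
From mathcomp Require Import all_boot all_order all_algebra.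
From mathcomp Require Import classical_sets cardinality.

Set Implicit Arguments.
Unset Strict Implicit.
Unset Printing Implicit Defensive.

Import Order.TTheory GRing.Theory Num.Theory.
Local Open Scope classical_set_scope.
Local Open Scope ring_scope.

(* Bi-infinite sequences over T are functions int -> T; a finite alphabet such
   as {+1, -1} is a set of values, imposed coordinatewise. *)
Definition full_shift (T : Type) (A : set T) : set (int -> T) :=
  [set x | forall i, A (x i)].

Definition subword (T : Type) (x : int -> T) (i : int) (n : nat) : seq T :=
  mkseq (fun k => x (i + k%:Z)) n.

Definition occurs_in (T : Type) (w : seq T) (x : int -> T) : Prop :=
  exists (i : int) (n : nat), w = subword x i n.

Definition language (T : Type) (X : set (int -> T)) : set (seq T) :=
  [set w | exists2 x, X x & occurs_in w x].

Definition synchronizing_word (T : Type) (X : set (int -> T)) (w : seq T) :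
    Prop :=
  language X w /\
  forall u v, language X u -> language X v ->
    language X (u ++ w) -> language X (w ++ v) -> language X (u ++ w ++ v).

Definition synchronizing_point (T : Type) (X : set (int -> T)) (x : int -> T) :
    Prop :=
  X x /\ exists2 w, synchronizing_word X w & occurs_in w x.

Definition non_synchronizing_points (T : Type) (X : set (int -> T)) :
    set (int -> T) :=
  [set x | X x /\ ~ synchronizing_point X x].

Definition charge_constrained_shift (c : int) : set (int -> int) :=
  [set x | full_shift [set 1; -1] x /\
     forall w, occurs_in w x -> - c <= \sum_(a <- w) a <= c].

(* Main.v *)
(* A point of X_c is the increment sequence of a height function of oscillation
   at most c. Heights vanishing at even integers and equal to an arbitrary
   sign at each odd integer give uncountably many points of oscillation at most
   2. Take a word w of such a point, going from height h to height h', let u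
   descend to h from c - 1 and v descend from h' to 1 - c. Since w stays in
   [-1, 1], both uw and wv have oscillation at most c, but uwv has sum
   2 - 2c < -c, as c > 2. So w is not synchronizing. *)

Require Import Defs.
From mathcomp Require Import all_boot all_order all_algebra.
From mathcomp Require Import zify.
From mathcomp Require Import boolp classical_sets cardinality.

Import Order.TTheory GRing.Theory Num.Theory.
Local Open Scope classical_set_scope.
Local Open Scope ring_scope.

Lemma uncountable_of_injective {T : Type} (A : set T) (f : (nat -> bool) -> T) :
  injective f -> (forall b, A (f b)) -> ~ countable A.
Proof.
move=> f_inj fA /countable_injP[g g_inj].
have gf_inj : injective (g \o f).
  by move=> b b' e; apply: f_inj; apply: g_inj; rewrite ?inE.
(* Cantor's diagonal: at the code [g (f b)] of each [b], the sequence [d] takes the value opposite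
   to that of [b], so [d] would differ from itself at its own code. *)
pose d n := `[< exists2 b, g (f b) = n & ~~ b n >].
have [dd|dd] := boolP (d (g (f d))).
  by have /asboolP[b /gf_inj ->] := dd; rewrite dd.
by move/asboolP: (dd); apply; exists d.
Qed.

Definition increments (G : int -> int) : int -> int := fun j => G (j + 1) - G j.

Definition unit_steps (G : int -> int) : Prop :=
  forall j, G (j + 1) = G j + 1 \/ G (j + 1) = G j - 1.

Lemma sum_increments (G : int -> int) (i : int) (n : nat) :
  \sum_(a <- subword (increments G) i n) a = G (i + n%:Z) - G i.
Proof.
rewrite /subword big_map -[n in iota 0 n]subn0 -/(index_iota 0 n) /increments.
under eq_bigr => k _ do rewrite -addrA -PoszD addn1.
by rewrite (telescope_sumr (fun k => G (i + k%:Z))) // addr0.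
Qed.

Lemma increments_charge_constrained (c lo : int) (G : int -> int) :
  unit_steps G -> (forall j : int, lo <= G j <= lo + c) ->
  charge_constrained_shift c (increments G).
Proof.
move=> G_step G_bnd; split=> [j|w [i [n ->]]].
  by rewrite /increments; have [->|->] := G_step j; [left|right] => /=; lia.
rewrite sum_increments.
have := G_bnd i; have := G_bnd (i + n%:Z); lia.
Qed.

(** Two paths that meet at one height can be spliced there. Each needs to stay in the common window
    only on the half-line that is kept. *)
Lemma glued_word_language (c lo : int) (G1 G2 : int -> int) (p q : int)
    (m n : nat) :
  unit_steps G1 -> unit_steps G2 -> G1 p = G2 q ->
  (forall j : int, j <= p -> lo <= G1 j <= lo + c) ->
  (forall j : int, q <= j -> lo <= G2 j <= lo + c) ->
  language (charge_constrained_shift c)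
    (subword (increments G1) (p - m%:Z) m ++ subword (increments G2) q n).
Proof.
move=> step1 step2 eqG bnd1 bnd2.
(* The junction is moved to time 0, where both formulas agree by [eqG]; hence no step straddles the
   two branches. *)
pose G (j : int) : int := if j <= 0 then G1 (p + j) else G2 (q + j).
have Gl (j : int) : j <= 0 -> G j = G1 (p + j) by rewrite /G => ->.
have Gr (j : int) : 0 <= j -> G j = G2 (q + j).
  rewrite /G; case: ifP => // j0 j0'; have -> : j = 0 by lia.
  by rewrite !addr0.
exists (increments G).
  apply: (@increments_charge_constrained _ lo) => j.
    have [j0|j0] := ltP j 0.
      by rewrite !Gl ?addrA; [exact: step1|lia|lia].
    by rewrite !Gr ?addrA; [exact: step2|lia|lia].
  have [j0|j0] := leP j 0; first by rewrite Gl //; apply: bnd1; lia.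
  by rewrite Gr; [apply: bnd2; lia|lia].
exists (- m%:Z), (m + n)%N.
rewrite /subword /mkseq iotaD map_cat add0n; congr (_ ++ _).
  apply/eq_in_map => k; rewrite mem_iota => k_lt.
  rewrite /increments !Gl; [|lia|lia].
  by congr (G1 _ - G1 _); lia.
rewrite -[in iota m n](addn0 m) iotaDl -map_comp.
apply: eq_map => k /=.
rewrite /increments !Gr; [|lia|lia].
by congr (G2 _ - G2 _); lia.
Qed.

(* Outside [0, 2K] the path zigzags: K, K - 1 on the left and - K, - K + 1 on the
   right, the residue of j mod 2 keeping the steps equal to 1 or -1. *)
Definition descent (K j : int) : int :=
  Num.max (Num.min (K - j) (K - (j %% 2)%Z)) (- K + (j %% 2)%Z).

Lemma descent_unit_steps (K : int) : unit_steps (descent K).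
Proof. by move=> j; rewrite /descent; lia. Qed.

Lemma descent_linear (K j : int) : 0 <= j <= 2 * K -> descent K j = K - j.
Proof. by rewrite /descent; lia. Qed.

Definition sign_heights (b : nat -> bool) (j : int) : int :=
  if (j %% 2)%Z == 0 then 0 else if b `|(j %/ 2)%Z|%N then 1 else -1.

Lemma sign_heights_bound (b : nat -> bool) (j : int) :
  -1 <= sign_heights b j <= 1.
Proof. by rewrite /sign_heights; case: ifP => // _; case: ifP. Qed.

Lemma sign_heights_unit_steps (b : nat -> bool) : unit_steps (sign_heights b).
Proof.
move=> j; rewrite /sign_heights; case: eqP; case: eqP => h1 h2.
- by exfalso; lia.
- by case: ifP => _; lia.
- by case: ifP => _; lia.
- by exfalso; lia.
Qed.

Lemma increments_sign_heights_inj :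
  injective (fun b => increments (sign_heights b)).
Proof.
(* The step from 2n to 2n + 1 starts at height 0, so it is the sign coded by [b n]; nonnegative
   positions suffice. *)
move=> b b' /(congr1 (fun x : int -> int => x \o (fun n : nat => 2 * n%:Z))) e.
apply/funext => n; have := congr1 (fun x => x n) e => /=.
rewrite /increments /sign_heights.
have -> : ((2 * n%:Z + 1) %% 2)%Z = 1 by lia.
have -> : ((2 * n%:Z) %% 2)%Z = 0 by lia.
have -> : `|((2 * n%:Z + 1) %/ 2)%Z|%N = n by lia.
by rewrite /=; case: (b n); case: (b' n).
Qed.

Lemma sign_heights_word_not_synchronizing (c : int) (b : nat -> bool)
    (i : int) (n : nat) : 2 < c ->
  ~ synchronizing_word (charge_constrained_shift c)
      (subword (increments (sign_heights b)) i n).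
Proof.
move=> c_gt2 [_ sync].
set H := sign_heights b in sync.
pose K : int := c - 1; pose D := descent K.
have stepD : unit_steps D by exact: descent_unit_steps.
have stepH : unit_steps H by exact: sign_heights_unit_steps.
(* [p] and [q] are the times at which the descent passes the heights of the two ends of the word. *)
pose i' := i + n%:Z; pose p := K - H i; pose q := K - H i'.
have Hi := sign_heights_bound b i; have Hi' := sign_heights_bound b i'.
rewrite -/H in Hi Hi'.
have Dp : D p = H i by rewrite /D descent_linear /p /K; lia.
have Dq : D q = H i' by rewrite /D descent_linear /q /K; lia.
have D0 : D 0 = K by rewrite /D descent_linear /K; lia.
have DK : D (2 * K) = - K by rewrite /D descent_linear /K; lia.
(* The prefix and the word share the window [-1, c - 1]; the word and the suffix share
   [1 - c, 1]. *)
have D_above (j : int) : j <= p -> -1 <= D j <= -1 + c.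
  by rewrite /D /descent /p /K; lia.
have D_below (j : int) : q <= j -> - K <= D j <= - K + c.
  by rewrite /D /descent /q /K; lia.
have H_above (j : int) : -1 <= H j <= -1 + c.
  by have := sign_heights_bound b j; rewrite -/H; lia.
have H_below (j : int) : - K <= H j <= - K + c.
  by have := sign_heights_bound b j; rewrite -/H /K; lia.
pose m := absz p; pose l := absz (2 * K - q)%R.
have pm : p - m%:Z = 0 by rewrite /m /p /K; lia.
have ql : q + l%:Z = 2 * K by rewrite /l /q /K; lia.
have i'n : i' - n%:Z = i by rewrite /i'; lia.
pose u := subword (increments D) 0 m; pose v := subword (increments D) q l.
(* The length [k] is left free: 0 gives [u] alone, [n] gives [u] followed by the word. *)
have uw k : language (charge_constrained_shift c)
    (u ++ subword (increments H) i k).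
  rewrite /u -pm; apply: (@glued_word_language c (-1)) => // j _; exact: H_above.
have wv k : language (charge_constrained_shift c)
    (subword (increments H) (i' - k%:Z) k ++ v).
  by apply: (@glued_word_language c (- K)) => // j _; exact: H_below.
have lu : language (charge_constrained_shift c) u.
  by have := uw 0; rewrite cats0.
have lv : language (charge_constrained_shift c) v by exact: (wv 0).
have := wv n; rewrite i'n => lwv.
have [x [_ x_bnd] /x_bnd] := sync u v lu lv (uw n) lwv.
(* The heights at both junctions cancel, leaving [D (2 * K) - D 0], that is -2K. *)
rewrite !big_cat /= !sum_increments add0r.
have -> : m%:Z = p by lia.
by rewrite ql -/i' Dp Dq D0 DK /K; lia.
Qed.

Theorem theorem6p1 (c : int) (hc : 2 < c) :
  ~ countable (non_synchronizing_points (charge_constrained_shift c)).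
Proof.
apply: (uncountable_of_injective _ _ increments_sign_heights_inj) => b; split.
  apply: (@increments_charge_constrained c (-1)) => [|j].
    exact: sign_heights_unit_steps.
  have := sign_heights_bound b j; lia.
case=> _ [w w_sync [i [n w_eq]]]; rewrite w_eq in w_sync.
exact: sign_heights_word_not_synchronizing hc w_sync.
Qed.
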